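(* Let $n\ge 1$. The map $\mathcal A$ (defined explicitly in the context) is a bijection from the set of Dyck paths of semilength $n$ onto the set of $n\times n$ alternating sign matrices which are determined by their X-rays.
   Context: An alternating sign matrix is a square matrix with entries in $\{0,1,-1\}$ such that the sum of each row and of each column is $1$, and the nonzero entries in each row and in each column alternate in sign. Matrix rows are numbered from top to bottom and columns from left to right, starting with $1$. For an $n\times n$ alternating sign matrix $A$, its (antidiagonal) X-ray is the vector $(x_1,\dots,x_{2n-1})$ with $x_k=\sum_{i+j=k+1}A_{i,j}$. An $n\times n$ alternating sign matrix $A$ is determined by its X-ray if no other $n\times n$ alternating sign matrix has the same X-ray as $A$. A Dyck path of semilength $n$ is drawn in an $n\times n$ square of cells, as a lattice path with unit east and south steps from the top left corner to the bottom right corner that never goes below the main diagonal. That is, it is a word with $n$ letters $E$ and $n$ letters $S$ such that every prefix contains at least as many $E$'s as $S$'s. A peak is an occurrence of an $E$ step immediately followed by an $S$ step; a valley is an occurrence of an $S$ step immediately followed by an $E$ step. The position of a peak or valley is the pair $(i,j)$, where $i$ is the number of $S$ steps and $j$ the number of $E$ steps up to and including the first of the two steps involved (so $i\le j$). The cell just south-west of this lattice point is the cell in row $i+1$ and column $j$ (and its mirror image in the main diagonal is the cell in row $j$ and column $i+1$). The map $\mathcal A$ sends a Dyck path $D$ of semilength $n$ to the following $n\times n$ matrix. For each peak of $D$ at position $(i,j)$, all cells $(a,b)$ with $a+b=i+j+1$ and $i+1\le a\le j$ (the cells on the antidiagonal between the peak and its mirror image in the main diagonal) are filled with $1$. For each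 valley of $D$ at position $(i,j)$, all cells $(a,b)$ with $a+b=i+j+1$ and $i+1\le a\le j$ are filled with $-1$ (there are none if $i=j$). All remaining cells are filled with $0$. *)

(* Defs.v *)
From HB Require Import structures.
From mathcomp Require Import all_boot all_order all_algebra.
From mathcomp Require Import classical_sets functions.

Set Implicit Arguments.
Unset Strict Implicit.
Unset Printing Implicit Defensive.

Import Order.TTheory GRing.Theory Num.Theory.
Local Open Scope ring_scope.
Local Open Scope classical_set_scope.

(* Matrix indices in 'I_n start from 0, so [i : 'I_n] is row (or column)
   number [i.+1]. *)

Definition alternating (s : seq int) : bool :=
  sorted (fun x y : int => x * y < 0) [seq x <- s | x != 0].

Definition is_asm (n : nat) (A : 'M[int]_n) : Prop :=
  [/\ forall i j, A i j \in [:: 0; 1; -1],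
      forall i, \sum_j A i j = 1,
      forall j, \sum_i A i j = 1,
      forall i, alternating [seq A i j | j <- enum 'I_n]
    & forall j, alternating [seq A i j | i <- enum 'I_n]].

(* The entry of index [k] is x_{k+1}. *)
Definition xray (n : nat) (A : 'M[int]_n) : 'rV[int]_(n.*2.-1) :=
  \row_(k < n.*2.-1)
    \sum_(c : 'I_n * 'I_n | (c.1.+1 + c.2.+1 == k.+1 + 1)%N) A c.1 c.2.

Definition determined_by_xray (n : nat) (A : 'M[int]_n) : Prop :=
  forall B : 'M[int]_n, is_asm B -> xray B = xray A -> B = A.

Definition xray_determined_asms (n : nat) : set 'M[int]_n :=
  [set A | is_asm A /\ determined_by_xray A].
Arguments xray_determined_asms : clear implicits.

Variant step : Set := East | South.

Definition is_east (s : step) : bool := if s is East then true else false.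
Definition step_of_bool (b : bool) : step := if b then East else South.
Lemma is_eastK : cancel is_east step_of_bool. Proof. by case. Qed.
HB.instance Definition _ := Equality.copy step (can_type is_eastK).

Definition dyck_paths (n : nat) : set (seq step) :=
  [set D | [/\ count_mem East D = n,
               count_mem South D = n
             & forall k, (count_mem South (take k D)
                            <= count_mem East (take k D))%N]].

(* Positions (i, j) of the occurrences of the step [s] immediately followed by
   the step [t]; the occurrence of index [k] consists of the letters [k] and
   [k.+1] of the word, and [take k.+1 D] ends with the first of them. *)
Definition corners (s t : step) (D : seq step) : seq (nat * nat) :=
  [seq (count_mem South (take k.+1 D), count_mem East (take k.+1 D))
     | k <- iota 0 (size D).-1 & (nth s D k == s) && (nth s D k.+1 == t)].

Definition peaks : seq step -> seq (nat * nat) := corners East South.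
Definition valleys : seq step -> seq (nat * nat) := corners South East.

(* [a] and [b] are numbered from 1 here. *)
Definition on_antidiagonal (a b : nat) (p : nat * nat) : bool :=
  (a + b == p.1 + p.2 + 1)%N && (p.1 + 1 <= a <= p.2)%N.

(* The order of the two tests is irrelevant: for a corner (i, j), i + j is the
   length of a prefix of the path, so distinct corners lie on distinct
   antidiagonals. *)
Definition calA (n : nat) (D : seq step) : 'M[int]_n :=
  \matrix_(a < n, b < n)
    if has (on_antidiagonal a.+1 b.+1) (peaks D) then 1
    else if has (on_antidiagonal a.+1 b.+1) (valleys D) then -1
    else 0.

(* Main.v *)
(* Work with the corner sums C(i, j) of a matrix. Alternating sign matrices
   correspond to the functions C with prescribed boundary values and all steps
   in {0, 1}, and two of them have the same X-ray iff their corner sums have the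
   same sums over all antidiagonals. The matrix of a Dyck path D has
   C(i, j) = min(i, j, S(i + j)), where S(k) counts the S steps among the first
   k letters of D, so D is recovered from the values near the diagonal.

   Such a C is determined: its row partial sums r(i, j) = C(i + 1, j) - C(i, j)
   are, on each antidiagonal i + j = m, the indicator of i < theta(m). If r' comes
   from a matrix with the same X-ray, the sum over all (i, j) of
   (r' - r)(i, j) (2 theta(i + j) - 2 i - 1) vanishes by Abel summation, while all
   its terms are nonpositive and vanish only where r' = r.

   Conversely, let C be determined. Transposition preserves the X-ray, so C is
   symmetric. Hence exchanging C(i, j) with C(i - 1, j + 1) on mirrored positions,
   for all i <= j with C(i, j) < i, again preserves antidiagonal sums, and it
   gives an admissible C. So C(i, j) = i or C(i - 1, j + 1) = C(i, j) above the
   diagonal, which forces the shape min(i, j, S(i + j)). *)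

Require Import Defs.
From mathcomp Require Import all_boot all_order all_algebra.
From mathcomp Require Import classical_sets functions.
From mathcomp Require Import zify.

Set Implicit Arguments.
Unset Strict Implicit.
Unset Printing Implicit Defensive.

Import Order.TTheory GRing.Theory Num.Theory.
Local Open Scope ring_scope.

(** * Corner-sum functions and their matrices *)

(** A total function on pairs of naturals, constrained only for indices up to [n]; values beyond are
    arbitrary. *)
Definition corner_fun (n : nat) (C : nat -> nat -> int) : Prop :=
  [/\ forall j, (j <= n)%N -> C 0%N j = 0 /\ C n j = j%:Z,
      forall i, (i <= n)%N -> C i 0%N = 0 /\ C i n = i%:Z,
      forall i j, (i < n)%N -> (j <= n)%N -> 0 <= C i.+1 j - C i j <= 1
    & forall i j, (i <= n)%N -> (j < n)%N -> 0 <= C i j.+1 - C i j <= 1].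

Definition corner_mx (n : nat) (C : nat -> nat -> int) : 'M[int]_n :=
  \matrix_(i, j) (C i.+1 j.+1 - C i j.+1 - (C i.+1 j - C i j)).

Definition corner_sum (n : nat) (A : 'M[int]_n) (i j : nat) : int :=
  \sum_(a < n | (a < i)%N) \sum_(b < n | (b < j)%N) A a b.

(** * Alternation of signs and bounded partial sums *)

(** [x] is the sum accumulated before [s]. The last nonzero entry was 1 if that sum is 1 and -1 if
    it is 0, hence it is [2 * x - 1]. *)
Lemma bounded_sums_alternating (s : seq int) (x : int) :
  0 <= x <= 1 -> (forall k, 0 <= x + \sum_(y <- take k s) y <= 1) ->
  path (fun y z : int => y * z < 0) (2 * x - 1) [seq y <- s | y != 0].
Proof.
elim: s x => [|y s IH] x hx hs //=.
have hy : 0 <= x + y <= 1 by have := hs 1%N; rewrite /= take0 big_seq1.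
have hs' k : 0 <= x + y + \sum_(z <- take k s) z <= 1.
  by have := hs k.+1; rewrite /= big_cons addrA.
have := IH _ hy hs'; case: ifP => /= [/eqP y0|/negbT/negPn/eqP y0]; last first.
  by rewrite y0 addr0.
have -> : 2 * (x + y) - 1 = y by lia.
move=> ->; rewrite andbT; nia.
Qed.

(** With [x] as the preceding nonzero entry, the next one is [- x], and from there the contributions
    cancel in turn. *)
Lemma alternating_sums_bounded (s : seq int) (x : int) :
  x = 1 \/ x = -1 -> all (fun y => y \in [:: 0; 1; -1]) s ->
  path (fun y z : int => y * z < 0) x [seq y <- s | y != 0] ->
  forall k, \sum_(y <- take k s) y = 0 \/ \sum_(y <- take k s) y = - x.
Proof.
elim: s x => [|y s IH] x hx /=; first by left; rewrite big_nil.
case/andP=> hy hs; case: ifP => /= [y0|/negbT/negPn/eqP y0].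
  case/andP=> xy hp [|k] /=; first by left; rewrite big_nil.
  rewrite big_cons; have hy' : y = - x.
    by move: hy y0 xy; rewrite !inE; case: hx => -> /or3P[] /eqP ->.
  have y1 : y = 1 \/ y = -1 by lia.
  by have [->|->] := IH y y1 hs hp k; [right; rewrite addr0 hy'|left; rewrite subrr].
move=> hp [|k] /=; first by left; rewrite big_nil.
by rewrite big_cons y0 add0r; apply: IH.
Qed.

Lemma sum_take_enum (n : nat) (f : 'I_n -> int) (k : nat) :
  \sum_(y <- take k [seq f i | i <- enum 'I_n]) y = \sum_(i < n | (i < k)%N) f i.
Proof.
have -> : \sum_(i < n | (i < k)%N) f i = \sum_(i <- enum 'I_n | (i < k)%N) f i.
  by rewrite big_enum_cond.
rewrite -map_take big_map.
rewrite -[in RHS](cat_take_drop k (enum 'I_n)) big_cat /=.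
rewrite [X in _ + X]big1_seq ?addr0; last first.
  move=> i /andP[ik] /(nthP i)[l]; rewrite size_drop size_enum_ord => hl.
  by rewrite nth_drop => e; move: ik; rewrite -e nth_enum_ord; lia.
rewrite [RHS]big_seq_cond big_seq; apply: eq_bigl => i; apply/idP/andP => [ii|[] //].
split=> //; have /(nthP i)[l] := ii; rewrite size_take size_enum_ord => hl.
by rewrite nth_take => [<-|]; rewrite ?nth_enum_ord; move: hl; case: ifP; lia.
Qed.

Lemma alternating_line (n : nat) (f : 'I_n -> int) :
  (forall i, f i \in [:: 0; 1; -1]) -> \sum_i f i = 1 ->
  alternating [seq f i | i <- enum 'I_n] ->
  forall k, 0 <= \sum_(i < n | (i < k)%N) f i <= 1.
Proof.
move=> f01 fsum falt k.
have hs : all (fun y => y \in [:: 0; 1; -1]) [seq f i | i <- enum 'I_n].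
  by apply/allP=> y /mapP[i _ ->].
have htot : \sum_(y <- take n [seq f i | i <- enum 'I_n]) y = 1.
  by rewrite sum_take_enum -fsum; apply: eq_bigl => i; rewrite ltn_ord.
rewrite -sum_take_enum.
(* A fictitious entry in front of the line: the opposite of its first nonzero entry, or 1 if there
   is none. *)
have [x hx hp] : exists2 x : int, x = 1 \/ x = -1 &
    path (fun y z : int => y * z < 0) x
      [seq y <- [seq f i | i <- enum 'I_n] | y != 0].
  move: falt; rewrite /alternating; case E: [seq _ <- _ | _] => [|z t] /=.
    by exists 1; [left|].
  move=> hp; have : z \in z :: t by rewrite inE eqxx.
  rewrite -E mem_filter => /andP[z0 zin]; have := allP hs _ zin.
  rewrite !inE (negPf z0) /= => hz; exists (- z); last first.
    by rewrite /= hp andbT; case/orP: hz => /eqP ->.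
  by case/orP: hz => /eqP ->; [right|left]; lia.
(* Partial sums are 0 or [- x], and the total 1 forces [x = -1]. *)
have H := alternating_sums_bounded hx hs hp.
have := H n; rewrite htot; have := H k; lia.
Qed.

Lemma line_alternating (n : nat) (f : 'I_n -> int) :
  (forall k, 0 <= \sum_(i < n | (i < k)%N) f i <= 1) ->
  alternating [seq f i | i <- enum 'I_n].
Proof.
move=> hf; have := @bounded_sums_alternating [seq f i | i <- enum 'I_n] 0 isT.
rewrite /alternating; case: [seq _ <- _ | _] => [|z t] //=.
case/(_ _)/andP => [k|_] //.
by rewrite add0r sum_take_enum.
Qed.

(** * Correspondence between alternating sign matrices and corner sums *)

Lemma sum_ord_telescope (n : nat) (F : nat -> int) (k : nat) :
  (k <= n)%N -> \sum_(i < n | (i < k)%N) (F i.+1 - F i) = F k - F 0%N.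
Proof.
move=> kn; rewrite -(big_ord_widen n (fun i => F i.+1 - F i) kn).
by elim: k {kn} => [|k IH]; rewrite ?big_ord0 ?subrr // big_ord_recr /= IH; lia.
Qed.

Lemma sum_ord_cap (n : nat) (f : 'I_n -> int) (k : nat) :
  \sum_(i < n | (i < k)%N) f i = \sum_(i < n | (i < minn n k)%N) f i.
Proof. by apply: eq_bigl => i; rewrite leq_min ltn_ord. Qed.

Lemma corner_fun_tr (n : nat) (C : nat -> nat -> int) :
  corner_fun n C -> corner_fun n (fun i j => C j i).
Proof. by case=> *; split; auto. Qed.

Lemma corner_mx_tr (n : nat) (C : nat -> nat -> int) :
  (corner_mx n C)^T = corner_mx n (fun i j => C j i).
Proof. by apply/matrixP => i j; rewrite !mxE; lia. Qed.

Lemma corner_mx_row (n : nat) (C : nat -> nat -> int) (i : 'I_n) (k : nat) :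
  corner_fun n C -> (k <= n)%N ->
  \sum_(j < n | (j < k)%N) corner_mx n C i j = C i.+1 k - C i k.
Proof.
case=> _ C0 _ _ kn; under eq_bigr do rewrite mxE.
have := @sum_ord_telescope n (fun b => C i.+1 b - C i b) k kn.
have [-> _] := C0 i.+1 (ltn_ord i); have [-> _] := C0 i (ltnW (ltn_ord i)).
rewrite !subr0 => <-; apply: eq_bigr => j _; lia.
Qed.

Lemma corner_sumK (n : nat) (C : nat -> nat -> int) (i j : nat) :
  corner_fun n C -> (i <= n)%N -> (j <= n)%N ->
  corner_sum (corner_mx n C) i j = C i j.
Proof.
move=> hC hi hj; rewrite /corner_sum.
under eq_bigr do rewrite corner_mx_row //.
rewrite (@sum_ord_telescope n (C^~ j) i hi); case: hC => C0 _ _ _.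
by have [-> _] := C0 j hj; rewrite subr0.
Qed.

Lemma corner_mx_rows_alternating (n : nat) (C : nat -> nat -> int) (i : 'I_n) :
  corner_fun n C ->
  \sum_j corner_mx n C i j = 1 /\
  alternating [seq corner_mx n C i j | j <- enum 'I_n].
Proof.
move=> hC; split.
  have := corner_mx_row i hC (leqnn n); rewrite (eq_bigl predT) => [->|j].
    case: hC => _ C0 _ _; have [_ ->] := C0 i.+1 (ltn_ord i).
    by have [_ ->] := C0 i (ltnW (ltn_ord i)); lia.
  by rewrite ltn_ord.
apply: line_alternating => k; rewrite sum_ord_cap corner_mx_row ?geq_minl //.
by case: hC => _ _ H _; apply: H; rewrite ?geq_minl.
Qed.

Lemma corner_mx_asm (n : nat) (C : nat -> nat -> int) :
  corner_fun n C -> is_asm (corner_mx n C).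
Proof.
move=> hC; have hCt := corner_fun_tr hC.
have tr i j : corner_mx n C i j = corner_mx n (fun a b => C b a) j i.
  by rewrite -corner_mx_tr mxE.
split=> [i j|i|j|i|j]; try exact: (corner_mx_rows_alternating _ hC).1;
  try exact: (corner_mx_rows_alternating _ hC).2.
- case: hC => _ _ H _; rewrite mxE !inE.
  have := H i j (ltn_ord i) (ltnW (ltn_ord j)).
  have := H i j.+1 (ltn_ord i) (ltn_ord j); lia.
- by rewrite (eq_bigr _ (fun i _ => tr i j)) (corner_mx_rows_alternating _ hCt).1.
- by rewrite (eq_map (fun i => tr i j)) (corner_mx_rows_alternating _ hCt).2.
Qed.

Lemma asm_tr (n : nat) (A : 'M[int]_n) : is_asm A -> is_asm A^T.
Proof.
case=> A01 Ar Ac Aar Aac; split=> [i j|i|j|i|j]; first by rewrite mxE.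
- by under eq_bigr do rewrite mxE.
- by under eq_bigr do rewrite mxE.
- by under eq_map do rewrite mxE.
- by under eq_map do rewrite mxE.
Qed.

Lemma corner_sum_tr (n : nat) (A : 'M[int]_n) (i j : nat) :
  corner_sum A^T i j = corner_sum A j i.
Proof.
rewrite /corner_sum exchange_big /=; apply: eq_bigr => b _.
by apply: eq_bigr => a _; rewrite mxE.
Qed.

Lemma sum_ord_recr_lt (n : nat) (f : 'I_n -> int) (i : 'I_n) :
  \sum_(a < n | (a < i.+1)%N) f a = \sum_(a < n | (a < i)%N) f a + f i.
Proof.
rewrite (bigD1 i) //= addrC; congr (_ + _); apply: eq_bigl => a.
by rewrite ltnS [(a < i)%N]ltn_neqAle andbC.
Qed.

Lemma corner_sum_stepl (n : nat) (A : 'M[int]_n) (i : 'I_n) (j : nat) :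
  corner_sum A i.+1 j - corner_sum A i j = \sum_(b < n | (b < j)%N) A i b.
Proof. by rewrite /corner_sum sum_ord_recr_lt addrC addKr. Qed.

Lemma corner_sumE (n : nat) (A : 'M[int]_n) : corner_mx n (corner_sum A) = A.
Proof.
apply/matrixP => i j; rewrite mxE.
have := corner_sum_stepl A i j; have := corner_sum_stepl A i j.+1.
by rewrite sum_ord_recr_lt; lia.
Qed.

Lemma corner_fun_asm (n : nat) (A : 'M[int]_n) :
  is_asm A -> corner_fun n (corner_sum A).
Proof.
(* Only rows are treated; the transpose supplies the columns. *)
have half (B : 'M[int]_n) : is_asm B ->
    (forall i, (i <= n)%N -> corner_sum B i 0 = 0 /\ corner_sum B i n = i%:Z) /\
    (forall i j, (i < n)%N -> (j <= n)%N ->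
       0 <= corner_sum B i.+1 j - corner_sum B i j <= 1).
  case=> B01 Br _ Bar _; split=> [i hi|i j hi hj].
    rewrite /corner_sum; split; first by rewrite big1 // => a _; rewrite big1.
    rewrite (eq_bigr (fun=> 1)) => [|a _].
      by rewrite -(big_ord_widen n (fun=> 1) hi) sumr_const card_ord natz.
    by rewrite -(Br a); apply: eq_bigl => b; rewrite ltn_ord.
  by rewrite (corner_sum_stepl B (Ordinal hi)) alternating_line.
move=> hA; have [h1 h2] := half A hA; have [h3 h4] := half _ (asm_tr hA).
split=> [j hj|||i j hi hj] //; first by rewrite -!(corner_sum_tr A); apply: h3.
by rewrite -!(corner_sum_tr A); apply: h4.
Qed.

(** * Weighted antidiagonal sums and X-rays *)

(** Weights depending on [i + j] alone are test functions for antidiagonal sums. *)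
Definition wsum (n : nat) (g : nat -> int) (d : nat -> nat -> int) : int :=
  \sum_(i < n) \sum_(j < n) g (i + j)%N * d i j.

Lemma wsum_xray (n : nat) (g : nat -> int) (A : 'M[int]_n) :
  \sum_(i < n) \sum_(j < n) g (i + j)%N * A i j =
  \sum_(k < n.*2.-1) g k * xray A 0 k.
Proof.
rewrite pair_bigA /=.
have hk (c : 'I_n * 'I_n) : (c.1 + c.2 < n.*2.-1)%N.
  by have := ltn_ord c.1; have := ltn_ord c.2; lia.
rewrite (partition_big (fun c => Ordinal (hk c)) predT) //=.
apply: eq_bigr => k _; rewrite mxE mulr_sumr.
apply: eq_big => [c|c /eqP <-] //.
by rewrite -val_eqE /=; lia.
Qed.

Lemma xray_wsum (n : nat) (A B : 'M[int]_n) :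
  xray A = xray B <->
  forall g : nat -> int,
    \sum_(i < n) \sum_(j < n) g (i + j)%N * A i j =
    \sum_(i < n) \sum_(j < n) g (i + j)%N * B i j.
Proof.
split=> [AB g|AB]; first by rewrite !wsum_xray AB.
(* The indicator of one antidiagonal extracts one coordinate. *)
apply/rowP => k; pose g (m : nat) : int := (m == k)%:R.
have gE M : \sum_(l < n.*2.-1) g l * xray M 0 l = xray M 0 k.
  rewrite (bigD1 k) //= /g eqxx mul1r big1 ?addr0 // => l lk.
  by rewrite val_eqE (negPf lk) mul0r.
by have := AB g; rewrite !(wsum_xray g) !gE.
Qed.

Lemma sum_ord_shift (n : nat) (f : nat -> int) :
  f 0%N = 0 -> f n = 0 -> \sum_(i < n) f i.+1 = \sum_(i < n) f i.
Proof.
move=> f0 fn; have : \sum_(i < n.+1) f i = \sum_(i < n.+1) f i by [].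
by rewrite {1}big_ord_recl big_ord_recr /= f0 fn add0r addr0.
Qed.

Lemma wsum_shiftl (n : nat) (g : nat -> int) (d : nat -> nat -> int) :
  (forall j, (j < n)%N -> d 0%N j = 0 /\ d n j = 0) ->
  wsum n (fun m => g m.+1) (fun i j => d i.+1 j) = wsum n g d.
Proof.
move=> d0; rewrite /wsum.
rewrite -(@sum_ord_shift n (fun i => \sum_(j < n) g (i + j)%N * d i j)) //;
  by rewrite big1 // => j _; have [h1 h2] := d0 j (ltn_ord j); rewrite ?h1 ?h2 mulr0.
Qed.

Lemma wsum_tr (n : nat) (g : nat -> int) (d : nat -> nat -> int) :
  wsum n g (fun i j => d j i) = wsum n g d.
Proof.
rewrite /wsum exchange_big; apply: eq_bigr => i _; apply: eq_bigr => j _.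
by rewrite addnC.
Qed.

Lemma wsum_shiftr (n : nat) (g : nat -> int) (d : nat -> nat -> int) :
  (forall i, (i < n)%N -> d i 0%N = 0 /\ d i n = 0) ->
  wsum n (fun m => g m.+1) (fun i j => d i j.+1) = wsum n g d.
Proof.
by move=> d0; rewrite -wsum_tr (@wsum_shiftl n g (fun i j => d j i)) // wsum_tr.
Qed.

Lemma wsumD (n : nat) (g : nat -> int) (d e : nat -> nat -> int) :
  wsum n g (fun i j => d i j + e i j) = wsum n g d + wsum n g e.
Proof.
rewrite /wsum -big_split; apply: eq_bigr => i _; rewrite -big_split.
by apply: eq_bigr => j _; rewrite mulrDr.
Qed.

Lemma wsumN (n : nat) (g : nat -> int) (d : nat -> nat -> int) :
  wsum n g (fun i j => - d i j) = - wsum n g d.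
Proof.
rewrite /wsum -sumrN; apply: eq_bigr => i _; rewrite -sumrN.
by apply: eq_bigr => j _; rewrite mulrN.
Qed.

Lemma wsumB (n : nat) (g : nat -> int) (d e : nat -> nat -> int) :
  wsum n g (fun i j => d i j - e i j) = wsum n g d - wsum n g e.
Proof. by rewrite wsumD wsumN. Qed.

Definition boundary0 (n : nat) (d : nat -> nat -> int) : Prop :=
  forall i, (i <= n)%N -> [/\ d i 0%N = 0, d i n = 0, d 0%N i = 0 & d n i = 0].

Lemma corner_funB0 (n : nat) (C C' : nat -> nat -> int) :
  corner_fun n C -> corner_fun n C' -> boundary0 n (fun i j => C i j - C' i j).
Proof.
move=> [C0 C1 _ _] [C0' C1' _ _] i hi.
have [-> ->] := C0 i hi; have [-> ->] := C1 i hi.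
by have [-> ->] := C0' i hi; have [-> ->] := C1' i hi; rewrite !subrr.
Qed.

(** Summation by parts turns the mixed difference of [d] into a second difference of the weight.
    Truncated predecessors occur only for [m <= 1], where [i] or [j] is 0 and [d] vanishes. *)
Lemma wsum_laplace (n : nat) (g : nat -> int) (d : nat -> nat -> int) :
  boundary0 n d ->
  wsum n g (fun i j => d i.+1 j.+1 - d i j.+1 - (d i.+1 j - d i j)) =
  wsum n (fun m => g m.-2 - g m.-1 *+ 2 + g m) d.
Proof.
move=> d0; rewrite !wsumB.
rewrite (@wsum_shiftl n (fun m => g m.-1) (fun i j => d i j.+1)); last first.
  by move=> j hj; have [] := d0 j.+1 hj.
rewrite (@wsum_shiftr n (fun m => g m.-2) d); last first.
  by move=> i /ltnW hi; have [] := d0 i hi.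
rewrite (@wsum_shiftr n (fun m => g m.-1) d); last first.
  by move=> i /ltnW hi; have [] := d0 i hi.
rewrite (@wsum_shiftl n (fun m => g m.-1) d); last first.
  by move=> i /ltnW hi; have [] := d0 i hi.
rewrite /wsum -!sumrB; apply: eq_bigr => i _.
rewrite -!sumrB; apply: eq_bigr => j _; rewrite mulrDl mulrBl mulrnAl; lia.
Qed.

(** A second-order recurrence started at 0, 0; the state is the pair of [g m] and [g m.+1]. *)
Lemma laplace_solve (G : nat -> int) :
  exists g : nat -> int, forall m, g m - g m.+1 *+ 2 + g m.+2 = G m.+2.
Proof.
pose p := nat_rect (fun=> (int * int)%type) (0, 0)
  (fun m xy => (xy.2, G m.+2 + xy.2 *+ 2 - xy.1)).
by exists (fun m => (p m).1) => m /=; lia.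
Qed.

Lemma xray_cornerP (n : nat) (C C' : nat -> nat -> int) :
  corner_fun n C -> corner_fun n C' ->
  xray (corner_mx n C) = xray (corner_mx n C') <->
  forall g, wsum n g (fun i j => C i j - C' i j) = 0.
Proof.
move=> hC hC'; have d0 := corner_funB0 hC hC'.
have E g : wsum n (fun m => g m.-2 - g m.-1 *+ 2 + g m) (fun i j => C i j - C' i j) =
    \sum_(i < n) \sum_(j < n) g (i + j)%N * corner_mx n C i j -
    \sum_(i < n) \sum_(j < n) g (i + j)%N * corner_mx n C' i j.
  rewrite -wsum_laplace // /wsum -sumrB; apply: eq_bigr => i _.
  rewrite -sumrB; apply: eq_bigr => j _; rewrite !mxE -mulrBr; congr (_ * _); lia.
rewrite xray_wsum; split=> H g; last first.
  by apply/eqP; rewrite -subr_eq0 -E H.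
have [f hf] := laplace_solve g; have := E f; rewrite H subrr => <-.
apply: eq_bigr => i _; apply: eq_bigr => j _.
have [di0 _ _ _] := d0 i (ltnW (ltn_ord i)).
have [_ _ d0j _] := d0 j (ltnW (ltn_ord j)).
(* On the boundary the difference is 0; elsewhere [i + j >= 2], where [f] has the prescribed second
   difference. *)
case: (nat_of_ord i) di0 => [|a] di0; first by rewrite d0j !mulr0.
case: (nat_of_ord j) => [|b]; first by rewrite di0 !mulr0.
by rewrite addSn addnS /= hf.
Qed.

Lemma determined_cornerP (n : nat) (C : nat -> nat -> int) :
  corner_fun n C ->
  determined_by_xray (corner_mx n C) <->
  forall C', corner_fun n C' ->
    (forall g, wsum n g (fun i j => C' i j - C i j) = 0) ->
    forall i j, (i <= n)%N -> (j <= n)%N -> C' i j = C i j.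
Proof.
move=> hC; split=> [H C' hC' hw i j hi hj | H B hB hx].
  rewrite -(corner_sumK hC' hi hj) -(corner_sumK hC hi hj).
  suff -> : corner_mx n C' = corner_mx n C by [].
  by apply: H; [exact: corner_mx_asm | exact/(xray_cornerP hC' hC)].
have hCB := corner_fun_asm hB; rewrite -(corner_sumE B) in hx *.
have E := H _ hCB ((xray_cornerP hCB hC).1 hx).
by apply/matrixP => i j; rewrite !mxE !E // ltnW.
Qed.

(** * Exchanging corner sums across the superdiagonal *)

(* For symmetric [C], [C a b - gap n C b a + gap n C a.+1 b.-1] exchanges the
   values at (j, i) and (i - 1, j + 1), which lie on the same antidiagonal, for
   all i <= j with [C i j < i]; the junk value [b.-1] at [b = 0] is harmless. *)
Definition gap (n : nat) (C : nat -> nat -> int) (i j : nat) : int :=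
  if [&& (0 < i)%N, (i <= j)%N, (j < n)%N & C i j < i%:Z]
  then C i j - C i.-1 j.+1 else 0.

Lemma corner_le (n : nat) (C : nat -> nat -> int) (i j : nat) :
  corner_fun n C -> (i <= n)%N -> (j <= n)%N -> C i j <= i%:Z.
Proof.
case=> C0 _ Cv _; elim: i => [|i IH] hi hj; first by have [-> _] := C0 j hj.
by have := Cv i j hi hj; have := IH (ltnW hi) hj; lia.
Qed.

(** These zeros keep the boundary values under the exchange. If [C 1 i < 1], it equals
    [C 0 i.+1 = 0]; if [C i n.-1 < i], it equals [C i.-1 n = i - 1]. *)
Lemma gap_boundary (n : nat) (C : nat -> nat -> int) (i : nat) :
  corner_fun n C -> (i <= n)%N ->
  [/\ gap n C n i = 0, gap n C i 0 = 0, gap n C i n = 0,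
      gap n C 1 i = 0 & gap n C i n.-1 = 0].
Proof.
move=> [C0 C1 Cv Ch] hi; rewrite /gap; split.
- by case: ifP => // /and4P[]; lia.
- by case: ifP => // /and4P[]; lia.
- by case: ifP => // /and4P[]; lia.
- case: ifP => // /and4P[_ i1 hin] /=; have [+ _] := C0 i hi.
  have [+ _] := C0 i.+1 hin; have n0 : (0 < n)%N by lia.
  have := Cv 0%N i n0 hi; lia.
- case: ifP => // /and4P[i0 i1 hin h]; have [_ +] := C1 i hi.
  have [_ +] := C1 i.-1 (leq_trans (leq_pred i) hi).
  have n1 : (n.-1 < n)%N by lia.
  have := Ch i n.-1 hi n1; rewrite prednK; lia.
Qed.

(** The [gap_step] lemmas check the steps of the exchanged function. For [i <= j] a position stays
    unchanged exactly when [C i j = i]. If two neighbours in one half are both exchanged, the new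
    step is a step of [C] elsewhere; if only one is, saturation of the other makes its gap 0. The
    second conjunct, taken at [i = j], is the step from the diagonal to the superdiagonal. *)
Lemma gap_step_right (n : nat) (C : nat -> nat -> int) (i j : nat) :
  corner_fun n C -> (0 < i)%N -> (i <= j)%N -> (j < n)%N ->
  (0 <= C i j.+1 - gap n C i j.+1 - (C i j - gap n C i j) <= 1) &&
  (0 <= C i j.+1 - (C i j - gap n C i j) <= 1).
Proof.
case=> _ _ Cv Ch; case: i => // i _ ij jn; rewrite /gap /=.
have iN : (i < n)%N by lia.
have := Cv i j iN (ltnW jn); have := Cv i j.+1 iN jn.
have := Ch i j (ltnW iN) jn; have := Ch i.+1 j iN jn.
have [j2|j2] := ltnP j.+1 n; last first.
  rewrite /= andbF jn ij /=; case: ifP; lia.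
have := Cv i j.+2 iN j2.
have := Ch i j.+1 (ltnW iN) j2; have := Ch i.+1 j.+1 iN j2.
rewrite jn ij (leqW ij) /=; case: ifP; case: ifP; lia.
Qed.

Lemma gap_step_down (n : nat) (C : nat -> nat -> int) (i j : nat) :
  corner_fun n C -> (i < j)%N -> (j < n)%N ->
  (0 <= C i.+1 j - gap n C i.+1 j - (C i j - gap n C i j) <= 1).
Proof.
move=> hC ij jn; have iN : (i < n)%N by lia.
have := corner_le hC (ltnW iN) (ltnW jn); have := corner_le hC iN jn.
have := corner_le hC (ltnW iN) jn; have := corner_le hC iN (ltnW jn).
case: hC => C0 _ Cv Ch; rewrite /gap /=.
have := Cv i j iN (ltnW jn); have := Cv i j.+1 iN jn.
have := Ch i j (ltnW iN) jn; have := Ch i.+1 j iN jn.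
rewrite jn ij (ltnW ij) /=.
case: i ij iN => [|i] ij iN /=.
  by have [-> _] := C0 j (ltnW jn); have [-> _] := C0 j.+1 jn; case: ifP; lia.
have := Cv i j.+1 (ltnW iN) jn; have := Cv i j (ltnW iN) (ltnW jn).
have := Ch i j (ltnW (ltnW iN)) jn; case: ifP; case: ifP; lia.
Qed.

(** An exchanged diagonal value comes from [C i i.+2], which is also adjacent to the fixed position
    [(i, i + 1)]. *)
Lemma gap_step_diag (n : nat) (C : nat -> nat -> int) (i : nat) :
  corner_fun n C -> (i < n)%N ->
  0 <= C i.+1 i.+1 - gap n C i.+1 i.+1 - C i i.+1 <= 1.
Proof.
case=> C0 _ Cv Ch iN; rewrite /gap ltnS leqnn /=.
have := Cv i i.+1 iN iN.
case: ifP => [/andP[i1]|]; last by lia.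
by have := Ch i i.+1 (ltnW iN) i1; lia.
Qed.

Lemma gap_step_up (n : nat) (C : nat -> nat -> int) (i j : nat) :
  corner_fun n C -> (i < n)%N -> (j < n)%N ->
  0 <= C i.+1 j.+1 + gap n C i.+2 j - (C i j.+1 + gap n C i.+1 j) <= 1.
Proof.
move=> hC iN jn; case: (hC) => C0 _ Cv Ch; rewrite /gap /= jn.
have := Cv i j.+1 iN jn; have := Cv i j iN (ltnW jn).
have := Ch i j (ltnW iN) jn; have := Ch i.+1 j iN jn.
have [ij|ij] := leqP i.+2 j; last first.
  by have [ij'|ij'] := ltnP i j; rewrite /=; [case: ifP|]; lia.
have i2 : (i.+1 < n)%N by lia.
have := corner_le hC iN (ltnW jn); have := corner_le hC i2 (ltnW jn).
have := corner_le hC (ltnW iN) jn; have := corner_le hC iN jn.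
rewrite (ltnW ij) /=.
have := Cv i.+1 j i2 (ltnW jn); have := Cv i.+1 j.+1 i2 jn.
by have := Ch i.+2 j i2 jn; case: ifP; case: ifP; lia.
Qed.

Lemma gap_step_across (n : nat) (C : nat -> nat -> int) (i j : nat) :
  corner_fun n C -> (i < j)%N -> (j < n)%N ->
  0 <= C i j.+1 + gap n C i.+1 j - (C i j + gap n C i.+1 j.-1) <= 1.
Proof.
move=> hC; case: j => // j ij jn; case: (hC) => C0 _ Cv Ch; rewrite /gap /= jn.
have iN : (i < n)%N by lia.
have jn' := ltnW jn; have jn'' := ltnW jn'.
have := Cv i j.+2 iN jn; have := Cv i j.+1 iN jn'; have := Cv i j iN jn''.
have := Ch i j (ltnW iN) jn'; have := Ch i j.+1 (ltnW iN) jn.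
have := Ch i.+1 j iN jn'; have := Ch i.+1 j.+1 iN jn.
have := corner_le hC iN jn'; have := corner_le hC iN jn''.
have := corner_le hC (ltnW iN) jn.
rewrite jn' ij /=.
by have [ij'|ij'] := ltnP i j; rewrite /=; do ?case: ifP; lia.
Qed.

(** The exchange is the reflection [(a, b) -> (b - 1, a + 1)], which fixes the superdiagonal. Steps
    are checked below this axis, at it and above it. *)
Lemma corner_fun_swap (n : nat) (C : nat -> nat -> int) :
  corner_fun n C -> (forall i j, (i <= n)%N -> (j <= n)%N -> C i j = C j i) ->
  corner_fun n (fun a b => C a b - gap n C b a + gap n C a.+1 b.-1).
Proof.
move=> hC Cs; have hg := gap_boundary hC.
have gap_out i j : (n < i)%N -> gap n C i j = 0.
  by rewrite /gap; case: ifP => // /and4P[]; lia.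
case: (hC) => [C0 C1 Cv Ch]; split=> [j hj|i hi|i j hi hj|i j hi hj].
- have [_ -> -> _ _] := hg j hj; rewrite (gap_out n.+1) //.
  have [_ _ _ -> _] := hg j.-1 (leq_trans (leq_pred j) hj).
  by have := C0 j hj; lia.
- have [-> _ _ _ _] := hg i hi; rewrite !subr0.
  have [-> ->] := C1 i hi.
  suff -> : gap n C i.+1 n.-1 = 0 by rewrite addr0.
  move: hi; rewrite leq_eqVlt => /orP[/eqP ->|hi]; first by rewrite gap_out.
  by have [_ _ _ _] := hg i.+1 hi.
- have [ji|ij] := leqP j i.
    have -> : gap n C i.+2 j.-1 = 0 by rewrite /gap; case: ifP; lia.
    have -> : gap n C i.+1 j.-1 = 0 by rewrite /gap; case: ifP; lia.
    rewrite !addr0 (Cs i.+1 j) ?(Cs i j) ?(ltnW hi) //.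
    case: j hj ji => [|j] hj ji.
      by rewrite /gap /= !subr0; apply: Ch.
    by have /andP[] := gap_step_right hC (ltn0Sn j) ji hi.
  case: j hj ij => // j hj; rewrite ltnS leq_eqVlt => /orP[/eqP ij|ij] /=.
    have -> : gap n C i.+2 j = 0 by rewrite /gap; case: ifP; lia.
    have -> : gap n C i.+1 j = 0 by rewrite /gap; case: ifP; lia.
    have -> : gap n C j.+1 i = 0 by rewrite /gap; case: ifP; lia.
    by rewrite ij; have := gap_step_diag hC hj; lia.
  have -> : gap n C j.+1 i.+1 = 0 by rewrite /gap; case: ifP; lia.
  have -> : gap n C j.+1 i = 0 by rewrite /gap; case: ifP; lia.
  by rewrite !subr0; apply: gap_step_up.
- have [ij|ji|ij] := ltngtP i j.
  + have -> : gap n C j.+1 i = 0 by rewrite /gap; case: ifP; lia.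
    have -> : gap n C j i = 0 by rewrite /gap; case: ifP; lia.
    by rewrite !subr0; apply: gap_step_across.
  + have -> : gap n C i.+1 j.+1.-1 = 0 by rewrite /gap; case: ifP; lia.
    have -> : gap n C i.+1 j.-1 = 0 by rewrite /gap; case: ifP; lia.
    rewrite !addr0 (Cs i j.+1) ?(Cs i j) ?(ltnW hj) //.
    move: hi; rewrite leq_eqVlt => /orP[/eqP ->|hi]; last exact: gap_step_down.
    have [_ _ -> _ _] := hg j.+1 hj; have [_ _ -> _ _] := hg j (ltnW hj).
    by rewrite !subr0; apply: Cv.
  + rewrite ij.
    have -> : gap n C j.+1 j.+1.-1 = 0 by rewrite /gap; case: ifP; lia.
    have -> : gap n C j.+1 j.-1 = 0 by rewrite /gap; case: ifP; lia.
    rewrite !addr0 ?subr0; case: j hj {ij hi} => [|j] hj.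
      by rewrite /gap /= subr0; apply: Ch.
    by have /andP[] := gap_step_right hC (ltn0Sn j) (leqnn _) hj.
Qed.

Lemma wsum_swap (n : nat) (C : nat -> nat -> int) (g : nat -> int) :
  corner_fun n C ->
  wsum n g (fun a b => C a b - gap n C b a + gap n C a.+1 b.-1 - C a b) = 0.
Proof.
move=> hC; have hg := gap_boundary hC.
have -> : wsum n g (fun a b => C a b - gap n C b a + gap n C a.+1 b.-1 - C a b) =
    wsum n g (fun a b => gap n C a.+1 b.-1 - gap n C b a).
  by apply: eq_bigr => a _; apply: eq_bigr => b _; congr (_ * _); lia.
rewrite wsumB (wsum_tr n g (gap n C)).
(* The terms at [(a + 1, b - 1)] and at [(a, b)] both become [d] with weight [h], one by a row shift
   and the other by a column shift. *)
pose d a b := gap n C a b.-1; pose h m := g m.-1.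
have -> : wsum n g (fun a b => gap n C a.+1 b.-1) = wsum n h d.
  apply: (@wsum_shiftl n h d) => j hj.
  by have [] := hg j.-1 (leq_trans (leq_pred j) (ltnW hj)).
have <- : wsum n g (gap n C) = wsum n h d; last by rewrite subrr.
apply: (@wsum_shiftr n h d) => i hi.
by have [_ ? _ _ ?] := hg i (ltnW hi).
Qed.

(** * Shape of the corner sums of a determined matrix *)

Lemma determined_shape (n : nat) (C : nat -> nat -> int) :
  corner_fun n C -> determined_by_xray (corner_mx n C) ->
  (forall i j, (i <= n)%N -> (j <= n)%N -> C i j = C j i) /\
  (forall i j, (i <= j)%N -> (j <= n)%N ->
     C i j = Num.min i%:Z (C (i + j)./2 (uphalf (i + j)))).
Proof.
move=> hC hdet; have hu := (determined_cornerP hC).1 hdet.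
have Cs i j : (i <= n)%N -> (j <= n)%N -> C i j = C j i.
  move=> hi hj; symmetry; move: i j hi hj.
  apply: hu (corner_fun_tr hC) _ => g.
  by rewrite wsumB (wsum_tr _ _ C) subrr.
split=> // i j ij jn.
(* Determinacy makes the exchanged function equal to [C]; on and below the diagonal they differ by
   this gap alone. *)
have gap0 a b : (b <= a)%N -> (a <= n)%N -> gap n C b a = 0.
  move=> ba an.
  have := hu _ (corner_fun_swap hC Cs) (fun g => wsum_swap g hC) a b an.
  move/(_ (leq_trans ba an)).
  have -> : gap n C a.+1 b.-1 = 0 by rewrite /gap; case: ifP; lia.
  by lia.
(* Induction outwards from the centre of the antidiagonal. *)
have [k hk] : exists k, (k = (j - i)./2)%N by exists (j - i)./2.
elim: k i j ij jn hk => [|k IH] i j ij jn hk.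
  have -> : ((i + j)./2 = i)%N by lia.
  have -> : (uphalf (i + j) = j)%N by lia.
  have := corner_le hC (leq_trans ij jn) jn; lia.
have e : (i.+1 + j.-1 = i + j)%N by lia.
have ij' : (i.+1 <= j.-1)%N by lia.
have jn' : (j.-1 <= n)%N by lia.
have iN : (i < n)%N by lia.
have jN : (j.-1 < n)%N by lia.
have kE : k = (j.-1 - i.+1)./2 by lia.
have := IH i.+1 j.-1 ij' jn' kE; rewrite e => IHij.
have := gap0 j.-1 i.+1 ij' jn'; rewrite /gap ltn0Sn ij' jN /=.
have := corner_le hC iN jn'; have := corner_le hC (ltnW iN) jn.
case: (hC) => _ _ Cv Ch; have := Cv i j.-1 iN jn'.
have := Ch i j.-1 (ltnW iN) jN; rewrite prednK; last by lia.
(* If [C i.+1 j.-1 = i + 1], two steps give [C i j >= i]; otherwise the zero gap carries the central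
   value outwards. *)
by case: ifP; lia.
Qed.

(** * Corner sums of Dyck paths and injectivity *)

Definition souths (D : seq step) (k : nat) : nat := count_mem South (take k D).

Definition dyck_corner (D : seq step) (i j : nat) : int :=
  (minn (minn i j) (souths D (i + j)))%:Z.

Lemma souths_step (D : seq step) (k : nat) :
  (k < size D)%N -> souths D k.+1 = (souths D k + (nth East D k == South))%N.
Proof.
by move=> hk; rewrite /souths (take_nth East) // -cats1 count_cat /= addn0.
Qed.

Lemma count_steps (s : seq step) : (count_mem East s + count_mem South s)%N = size s.
Proof.
by rewrite -(count_predC (pred1 East) s); congr (_ + _)%N; apply: eq_count => -[].
Qed.

Lemma easts_souths (D : seq step) (k : nat) :
  (k <= size D)%N -> (count_mem East (take k D) = k - souths D k)%N.
Proof.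
by move=> hk; have := count_steps (take k D); rewrite size_takel // /souths; lia.
Qed.

Lemma dyckP (n : nat) (D : seq step) :
  dyck_paths n D <->
  [/\ size D = n.*2, souths D n.*2 = n &
      forall k, (k <= n.*2)%N -> ((souths D k).*2 <= k)%N].
Proof.
split=> [[hE hS hD]|[hs hS hD]].
  have hs : size D = n.*2 by rewrite -count_steps hE hS addnn.
  split=> // [|k hk]; first by rewrite /souths -hs take_size.
  by have := hD k; rewrite easts_souths ?hs // -/(souths D k); lia.
have hS' : count_mem South D = n by rewrite -hS /souths -hs take_size.
have hE' : count_mem East D = n by have := count_steps D; rewrite hS' hs; lia.
split=> // k.
have [hk|hk] := leqP k (size D).
  rewrite easts_souths // -/(souths D k).
  by have := hD k; rewrite -hs => /(_ hk); lia.
by rewrite (take_oversize (ltnW hk)) hE' hS'.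
Qed.

Lemma corner_fun_dyck (n : nat) (D : seq step) :
  dyck_paths n D -> corner_fun n (dyck_corner D).
Proof.
case/dyckP=> hs hS hD; rewrite /dyck_corner.
have hstep k : (k < n.*2)%N -> (souths D k <= souths D k.+1 <= (souths D k).+1)%N.
  by move=> hk; rewrite souths_step ?hs //; case: (_ == _); lia.
(* The last [n - j] letters contain at most [n - j] South steps, so at least [j] of the [n] come
   earlier. *)
have hend j : (j <= n)%N -> (j <= souths D (n + j))%N.
  move=> hj; have H k : (k <= n)%N -> (souths D n.*2 <= souths D (n.*2 - k) + k)%N.
    elim: k => [|k IH] hk; first by rewrite subn0 addn0.
    have := IH (ltnW hk); have := hstep (n.*2 - k.+1)%N.
    by rewrite (_ : (n.*2 - k.+1).+1 = n.*2 - k)%N; lia.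
  have := H (n - j)%N; rewrite hS (_ : n.*2 - (n - j) = n + j)%N; lia.
have hend' i : (i <= n)%N -> (i <= souths D (i + n))%N by rewrite addnC; apply: hend.
split=> [j hj|i hi|i j hi hj|i j hi hj].
- by have := hend j hj; split; lia.
- by have := hend' i hi; split; lia.
- by rewrite addSn; have := hstep (i + j)%N; lia.
- by rewrite addnS; have := hstep (i + j)%N; lia.
Qed.

(** A corner whose first letter has index [k] satisfies [i + j = k + 1], so only [k = a + b] can
    meet the cell. *)
Lemma has_corner (s t : step) (D : seq step) (a b : nat) :
  ((a + b).+1 < size D)%N ->
  has (on_antidiagonal a.+1 b.+1) (corners s t D) =
  [&& nth East D (a + b) == s, nth East D (a + b).+1 == t &
      (souths D (a + b).+1 <= a < (a + b).+1 - souths D (a + b).+1)%N].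
Proof.
move=> hab.
have nthE (u : step) k : (k < size D)%N -> nth u D k = nth East D k.
  exact: set_nth_default.
have cornerE k : (k.+1 < size D)%N ->
    on_antidiagonal a.+1 b.+1
      (count_mem South (take k.+1 D), count_mem East (take k.+1 D)) =
    (k == (a + b)%N) && (souths D k.+1 <= a < k.+1 - souths D k.+1)%N.
  move=> hk; rewrite /on_antidiagonal (easts_souths (ltnW hk)) -/(souths D k.+1) /=.
  have := count_steps (take k.+1 D).
  by rewrite size_takel ?(ltnW hk) // -/(souths D k.+1); lia.
apply/hasP/idP => [[p /mapP[k]]|/and3P[hs ht hc]].
  rewrite mem_filter mem_iota => /andP[/andP[hs ht] hk] ->.
  have hk' : (k.+1 < size D)%N by lia.
  rewrite cornerE // => /andP[/eqP kE hc]; subst k.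
  by rewrite -(nthE s) ?hs -1?(nthE s) ?ht ?hc // ltnW.
exists (count_mem South (take (a + b).+1 D), count_mem East (take (a + b).+1 D)).
  apply/mapP; exists (a + b)%N => //.
  by rewrite mem_filter mem_iota !(nthE s) ?hs ?ht ?(ltnW hab) //=; lia.
by rewrite cornerE // eqxx hc.
Qed.

(** The mixed difference at [(a, b)] sees only the letters of index [a + b] and [a + b + 1]:
    East-South gives 1 and South-East gives -1 within the range, equal letters give 0. *)
Lemma calA_corner (n : nat) (D : seq step) :
  dyck_paths n D -> calA n D = corner_mx n (dyck_corner D).
Proof.
case/dyckP=> hs hS hD; apply/matrixP => a b; rewrite !mxE.
have ha := ltn_ord a; have hb := ltn_ord b.
have hab : ((a + b).+1 < size D)%N by lia.
rewrite /peaks /valleys !has_corner // /dyck_corner addSn addnS.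
have := hD (a + b)%N; have := hD (a + b).+1; have := hD (a + b).+2.
rewrite !souths_step ?(ltnW hab) //.
case: (nth East D (a + b)); case: (nth East D (a + b).+1); rewrite /=.
all: move: (souths D _) => S; try case: ifP; lia.
Qed.

Lemma calA_inj (n : nat) (D D' : seq step) :
  dyck_paths n D -> dyck_paths n D' -> calA n D = calA n D' -> D = D'.
Proof.
move=> hD hD'; rewrite !calA_corner // => e.
have he i j : (i <= n)%N -> (j <= n)%N -> dyck_corner D i j = dyck_corner D' i j.
  move=> hi hj; rewrite -(corner_sumK (corner_fun_dyck hD) hi hj) e.
  exact: corner_sumK (corner_fun_dyck hD') hi hj.
case/dyckP: hD => hs _ hD; case/dyckP: hD' => hs' _ hD'.
(* Next to the diagonal, [2 S(k) <= k] makes [S(k)] the minimum. *)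
have hS k : (k <= n.*2)%N -> souths D k = souths D' k.
  move=> hk; have := he k./2 (uphalf k); rewrite /dyck_corner.
  rewrite (_ : (k./2 + uphalf k)%N = k); last by lia.
  by have := hD k hk; have := hD' k hk; lia.
apply: (@eq_from_nth _ East) => [|k hk]; first by rewrite hs hs'.
have := hS k.+1; rewrite !souths_step ?hS -?hs' ?hs //; try lia.
by case: (nth East D k); case: (nth East D' k) => //=; lia.
Qed.

(** * Matrices of Dyck paths are determined *)

(** On a fixed antidiagonal this is a threshold in [i]: the number of earlier letters that differ
    from the letter of index [i + j]. *)
Lemma dyck_corner_step (n : nat) (D : seq step) (i j : nat) :
  dyck_paths n D -> (i < n)%N -> (j < n)%N ->
  dyck_corner D i.+1 j - dyck_corner D i j =
  (i < if nth East D (i + j) == South then i + j - souths D (i + j)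
       else souths D (i + j))%N%:Z.
Proof.
case/dyckP=> hs hS hD hi hj; have hij : (i + j < size D)%N by lia.
rewrite /dyck_corner addSn souths_step //.
have := hD (i + j)%N; have := hD (i + j).+1; rewrite souths_step //.
by move: (souths D _) => S; case: (nth East D _); rewrite /=; lia.
Qed.

Lemma calA_determined (n : nat) (D : seq step) :
  dyck_paths n D -> determined_by_xray (calA n D).
Proof.
move=> hD; rewrite calA_corner //; have hC := corner_fun_dyck hD.
apply/determined_cornerP => // C' hC' hw.
pose th k := if nth East D k == South then (k - souths D k)%N else souths D k.
pose d i j := C' i j - dyck_corner D i j.
pose r i j := d i.+1 j - d i j.
have d0 : boundary0 n d by apply: corner_funB0.
have d0l j : (j < n)%N -> d 0%N j = 0 /\ d n j = 0.
  by move=> /ltnW hj; have [] := d0 j hj.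
have r_sum g : wsum n g r = 0.
  rewrite wsumB hw subr0.
  by rewrite -[RHS](hw (fun m => g m.-1)) -(@wsum_shiftl n (fun m => g m.-1) d).
(* Abel summation in [i]: the products [i * d i j] telescope, and the remaining sum of [d] is 0. *)
have ir_sum : \sum_(i < n) \sum_(j < n) i%:Z * r i j = 0.
  have -> : \sum_(i < n) \sum_(j < n) i%:Z * r i j =
      wsum n (fun=> 1) (fun i j => i.+1%:Z * d i.+1 j - i%:Z * d i j - d i.+1 j).
    apply: eq_bigr => i _; apply: eq_bigr => j _; rewrite /r mul1r; nia.
  rewrite !wsumB (@wsum_shiftl n (fun=> 1) (fun i j => i%:Z * d i j));
    last by move=> j /d0l[-> ->]; rewrite !mulr0.
  rewrite subrr sub0r -[RHS]oppr0 -[in RHS](hw (fun=> 1)); congr (- _).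
  by rewrite -wsumB; exact: (@wsum_shiftl n (fun=> 1) d d0l).
(* [r] is the difference r' - r, and the weight is odd, hence nonzero. *)
pose T i j := - (r i j * (2 * (th (i + j)%N)%:Z - 2 * i%:Z - 1)).
(* Below the threshold the old difference is 1, so [r <= 0] and the weight is positive; from the
   threshold on both signs reverse. *)
have T_ge0 i j : (i < n)%N -> (j < n)%N -> 0 <= T i j.
  move=> hi hj; have := dyck_corner_step hD hi hj; rewrite -/(th _).
  case: hC' => _ _ + _ => /(_ i j hi (ltnW hj)); rewrite /T /r /d.
  by case: ltnP; nia.
have T_sum : \sum_(p : 'I_n * 'I_n) T p.1 p.2 = 0.
  rewrite -(pair_bigA _ (fun i j : 'I_n => T i j)) /=.
  have := r_sum (fun m => 2 * (th m)%:Z - 1); rewrite /wsum => rs.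
  (* The weight splits into a multiple of [i] and a function of [i + j]; each part sums to 0. *)
  have -> : \sum_(i < n) \sum_(j < n) T i j =
      2 * (\sum_(i < n) \sum_(j < n) i%:Z * r i j) -
      \sum_(i < n) \sum_(j < n) (2 * (th (i + j)%N)%:Z - 1) * r i j.
    rewrite mulr_sumr -sumrB; apply: eq_bigr => i _.
    rewrite mulr_sumr -sumrB; apply: eq_bigr => j _; rewrite /T; nia.
  by rewrite ir_sum rs mulr0 subrr.
have r0 i j : (i < n)%N -> (j < n)%N -> r i j = 0.
  move=> hi hj; have := @psumr_eq0P _ _ predT _ _ T_sum (Ordinal hi, Ordinal hj) isT.
  have hT (p : 'I_n * 'I_n) : true -> 0 <= T p.1 p.2 by move=> _; apply: T_ge0.
  by move/(_ hT)/eqP; rewrite oppr_eq0 mulf_eq0 => /orP[/eqP|] //; lia.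
(* Column [n] is boundary; in the other columns zero row differences propagate the top row
   downwards. *)
move=> i j hi; rewrite leq_eqVlt => /orP[/eqP ->|hj].
  by apply/eqP; rewrite -subr_eq0 -/(d i n); have [_ -> _ _] := d0 i hi.
elim: i hi => [|i IH] hi; apply/eqP; rewrite -subr_eq0 -/(d _ _).
  by have [->] := d0l j hj.
by have := r0 i j hi hj; rewrite /r /d IH ?(ltnW hi) // subrr subr0 => ->.
Qed.

(** * Recovering the Dyck path from a determined matrix *)

Lemma determined_asm_calA (n : nat) (A : 'M[int]_n) :
  is_asm A -> determined_by_xray A -> exists2 D, dyck_paths n D & calA n D = A.
Proof.
move=> hA; rewrite -{1 2}(corner_sumE A); have hC := corner_fun_asm hA.
move: (corner_sum A) hC => C hC /(determined_shape hC)[Cs Cmin].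
(* The values nearest the diagonal, which must be the South counts of the path. *)
pose c k := C k./2 (uphalf k).
have C_ge0 i j : (i <= n)%N -> (j <= n)%N -> 0 <= C i j.
  case: (hC) => C0 _ Cv _; elim: i => [|i IH] hi hj; first by have [->] := C0 j hj.
  by have := IH (ltnW hi) hj; have := Cv i j hi hj; lia.
pose s k := `|c k|%N.
have cE k : (k <= n.*2)%N -> c k = (s k)%:Z.
  by move=> hk; rewrite /s gez0_abs //; apply: C_ge0; lia.
(* By symmetry the central positions of consecutive antidiagonals are adjacent in a column, so each
   increment is 0 or 1 and encodes a letter. *)
have s_step k : (k < n.*2)%N -> (s k <= s k.+1 <= (s k).+1)%N.
  move=> hk; have := cE k (ltnW hk); have := cE k.+1 hk; rewrite /c /=.
  have k1 : (k./2 < n)%N by lia.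
  have k2 : (uphalf k <= n)%N by lia.
  case: hC => _ _ Cv _; have := Cv k./2 (uphalf k) k1 k2.
  by rewrite (Cs (uphalf k)) //; lia.
pose D := mkseq (fun k => if s k.+1 == s k then East else South) n.*2.
have D_size : size D = n.*2 by rewrite size_mkseq.
have s0 : s 0%N = 0%N.
  by case: hC => C0 _ _ _; have [h _] := C0 0%N isT; rewrite /s /c h.
have D_souths k : (k <= n.*2)%N -> souths D k = s k.
  elim: k => [|k IH] hk; first by rewrite s0 /souths take0.
  rewrite souths_step ?D_size // IH ?(ltnW hk) // nth_mkseq //.
  by have := s_step k hk; case: (s k.+1 =P s k) => /=; lia.
have hD : dyck_paths n D.
  apply/dyckP; split=> // [|k hk].
    rewrite D_souths //; apply/eqP; rewrite -eqz_nat -cE // /c doubleK uphalf_double.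
    by case: hC => _ C1 _ _; have [_ ->] := C1 n (leqnn n).
  rewrite D_souths //; have := cE k hk.
  have : (k./2 <= n)%N by lia.
  have : (uphalf k <= n)%N by lia.
  by move=> h1 h2; have := corner_le hC h2 h1; rewrite /c; lia.
exists D => //; rewrite calA_corner //.
suff E i j : (i <= n)%N -> (j <= n)%N -> dyck_corner D i j = C i j.
  by apply/matrixP => i j; rewrite !mxE !E // ltnW.
have half a b : (a <= b)%N -> (b <= n)%N -> dyck_corner D a b = C a b.
  move=> hab hb; rewrite (Cmin a b hab hb) -/(c _) cE; last by lia.
  by rewrite /dyck_corner D_souths; lia.
move=> hi hj; have [ij|/ltnW ji] := leqP i j; first exact: half.
by rewrite Cs // -half // /dyck_corner minnC [(j + i)%N]addnC; lia.
Qed.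

Theorem theorem1p1 (n : nat) (hn : (1 <= n)%N) :
  set_bij (dyck_paths n) (xray_determined_asms n) (calA n).
Proof.
split.
- move=> D hD; split; last exact: calA_determined.
  by rewrite calA_corner //; apply/corner_mx_asm/corner_fun_dyck.
- by move=> D D' /set_mem hD /set_mem hD'; apply: calA_inj.
- by move=> A [hA hdet]; have [D hD <-] := determined_asm_calA hA hdet; exists D.
Qed.
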